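(* For every $n\in\mathbb{N}\cup\{\infty\}$ (with $0\in\mathbb{N}$) there is a simple, undirected, locally finite graph $G$ such that $\eta(\mathcal{A}_G)=n$, where $\mathcal{A}_G$ is the (closed) adjacency matrix of $G$ acting in $\ell^2(V)$ and $\eta(\mathcal{A}_G)$ is the common value of its deficiency indices.
   Context: A (simple, undirected) graph is a pair $G=(E,V)$, where $V$ is a countable set (the vertices) and $E\colon V\times V\to\{0,1\}$ is a symmetric function with $E(v,v)=0$ for all $v\in V$. Vertices $v,w$ with $E(v,w)=1$ are neighbours; the set of neighbours of $v$ is $\mathscr{N}_G(v)=\{w\in V : E(v,w)=1\}$. The graph is locally finite if $\mathscr{N}_G(v)$ is finite for every $v\in V$. All graphs are simple, undirected and locally finite. To $G$ one associates the complex Hilbert space $\ell^2(V)$ and the dense subspace $\mathcal{C}_c(G)$ of complex functions on $V$ with finite support. The adjacency matrix is the operator with domain $\mathcal{C}_c(G)$ given by $(\mathcal{A}_{G,\circ}f)(x)=\sum_{y\in\mathscr{N}_G(x)}f(y)$, $f\in\mathcal{C}_c(G)$. It is symmetric, hence closable, and $\mathcal{A}_G$ denotes its closure. For a closable densely defined symmetric operator $T$ on a complex Hilbert space, the deficiency indices are $\eta_\pm(T)=\dim\ker(T^*\mp \mathrm{i})\in\mathbb{N}\cup\{+\infty\}$, where $\mathrm{i}$ is the imaginary unit. When $\eta_+(T)=\eta_-(T)$, the common value is denoted $\eta(T)$. Since $\mathcal{A}_G$ commutes with complex conjugation, $\eta_+(\mathcal{A}_G)=\eta_-(\mathcal{A}_G)$,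 so $\eta(\mathcal{A}_G)$ is defined. *)

(* Defs.v *)
From HB Require Import structures.
From mathcomp Require Import all_boot all_order all_algebra.
From mathcomp Require Import all_classical all_reals all_analysis.
From mathcomp Require Import complex ring.

Set Implicit Arguments.
Unset Strict Implicit.
Unset Printing Implicit Defensive.

Import Order.TTheory GRing.Theory Num.Theory.
Import ComplexField.Normc.

Local Open Scope classical_set_scope.
Local Open Scope ring_scope.
Local Open Scope complex_scope.

Record graph := Graph {
  vertex :> countType ;
  edge : rel vertex ;
  edge_sym : symmetric edge ;
  edge_irrefl : irreflexive edge }.

Definition neighbours (G : graph) (v : G) : set G := [set w | edge v w].

Definition locally_finite (G : graph) := forall v : G, finite_set (neighbours v).

Section square_summable.
Variables (R : realType) (V : choiceType).
Implicit Types f g : V -> R[i].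

Definition square_summable : {pred V -> R[i]} := fun f =>
  `[< (\esum_(x in [set: V]) (normc (f x) ^+ 2)%:E < +oo)%E >].

Lemma normc_sqD (a b : R[i]) :
  normc (a + b) ^+ 2 <= 2 * normc a ^+ 2 + 2 * normc b ^+ 2.
Proof.
have ab := le_normcD a b.
have h0 (z : R[i]) : 0 <= normc z by case: z => u v; rewrite sqrtr_ge0.
apply: (le_trans (y := (normc a + normc b) ^+ 2)).
  by rewrite lerXn2r// ?nnegrE// addr_ge0.
rewrite -subr_ge0.
rewrite (_ : _ - _ = (normc a - normc b) ^+ 2) ?sqr_ge0//.
by ring.
Qed.

Lemma esumZ_lty (c : R) (u : V -> R) : 0 <= c -> (forall x, 0 <= u x) ->
  (\esum_(x in [set: V]) (u x)%:E < +oo)%E ->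
  (\esum_(x in [set: V]) (c * u x)%:E < +oo)%E.
Proof.
move=> c0 u0 fu; apply: (@le_lt_trans _ _
    (c%:E * \esum_(x in [set: V]) (u x)%:E)%E); last first.
  by apply: lte_mul_pinfty.
apply: ge_ereal_sup => _ [A fA <-].
rewrite (eq_fsbigr (fun x => c%:E * (u x)%:E)%E); last by [].
rewrite -ge0_mule_fsumr; last by move=> x; rewrite lee_fin.
apply: lee_wpmul2l => //.
by apply: ereal_sup_ubound; exists A.
Qed.

Lemma square_summable_submod_closed : submod_closed square_summable.
Proof.
split.
  apply/asboolP; rewrite esum1// => x _.
  by rewrite (_ : (0 : V -> R[i]) x = 0)// normc0 expr0n.
move=> c f g /asboolP ff /asboolP gg; apply/asboolP.
apply: (@le_lt_trans _ _ (\esum_(x in [set: V])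
   ((2 * normc c ^+ 2 * normc (f x) ^+ 2)%:E +
    (2 * normc (g x) ^+ 2)%:E))%E).
  apply: le_esum => x _; rewrite -EFinD lee_fin.
  apply: le_trans (normc_sqD _ _) _.
  by rewrite lerD2r normcM exprMn mulrA.
have sq0 (z : R) : 0 <= z ^+ 2 by rewrite sqr_ge0.
rewrite esumD; last 2 first.
- by move=> x _; rewrite lee_fin (mulr_ge0 (mulr_ge0 (ler0n _ 2) _)).
- by move=> x _; rewrite lee_fin mulr_ge0.
apply: lte_add_pinfty.
  exact: esumZ_lty (mulr_ge0 (ler0n _ 2) (sq0 _)) (fun=> sq0 _) ff.
exact: esumZ_lty (ler0n _ 2) (fun=> sq0 _) gg.
Qed.

Definition finitely_supported f := finite_set [set x | f x != 0].

Lemma finitely_supported_square_summable f :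
  finitely_supported f -> f \in square_summable.
Proof.
move=> fs; apply/asboolP.
have sq0 x : (0 <= (normc (f x) ^+ 2)%:E)%E by rewrite lee_fin sqr_ge0.
rewrite (_ : esum _ _ = \esum_(x in [set x | f x != 0%R]) (normc (f x) ^+ 2)%:E)%E.
  by rewrite esum_fset// fsbig_finite//= sumEFin ltry.
rewrite [RHS]esum_mkcond; apply: eq_esum => x _.
case: ifPn => //; rewrite notin_setE/= => /negP; rewrite negbK => /eqP ->.
by rewrite normc0 expr0n.
Qed.

HB.instance Definition _ := GRing.isSubmodClosed.Build _ _ square_summable
  square_summable_submod_closed.

End square_summable.

Record ell2 (R : realType) (V : choiceType) := Ell2 {
  ell2_fun :> V -> R[i] ;
  ell2P : ell2_fun \in @square_summable R V }.

HB.instance Definition _ (R : realType) (V : choiceType) :=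
  [isSub for @ell2_fun R V].
HB.instance Definition _ (R : realType) (V : choiceType) :=
  [Choice of ell2 R V by <:].
HB.instance Definition _ (R : realType) (V : choiceType) :=
  [SubChoice_isSubLmodule of ell2 R V by <:].

Section hilbert.
Variables (R : realType) (V : choiceType).
Local Notation H := (ell2 R V).

(* Unordered sums; the two halves of a difference are finite whenever [a] is
   absolutely summable. *)
Definition rsum (a : V -> R) : R :=
  fine (\esum_(x in [set: V]) (EFin \o a)^\+ x -
        \esum_(x in [set: V]) (EFin \o a)^\- x)%E.

Definition csum (a : V -> R[i]) : R[i] :=
  rsum (fun x => complex.Re (a x)) +i* rsum (fun x => complex.Im (a x)).

Definition ip (f g : H) : R[i] := csum (fun x => (f x)^* * g x).

Definition l2norm (f : H) : R :=
  Num.sqrt (fine (\esum_(x in [set: V]) (normc (f x) ^+ 2)%:E)%E).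

(* A partially defined operator is identified with its graph:
   [T (f, g)] means that [f] is in the domain of [T] and [T f = g]. *)
Definition operator := set (H * H).

Definition closure_op (T : operator) : operator :=
  [set p | forall e : R, 0 < e ->
     exists2 q, T q & l2norm (p.1 - q.1) < e /\ l2norm (p.2 - q.2) < e].

Definition adjoint (T : operator) : operator :=
  [set p | forall q, T q -> ip q.2 p.1 = ip q.1 p.2].

(* ker (T - z), with T given by its graph *)
Definition eigenspace_op (T : operator) (z : R[i]) : set H :=
  [set f | T (f, z *: f)].

End hilbert.

Section dimension.
Variables (K : fieldType) (L : lmodType K).

Definition basis_in (S : set L) n (b : 'I_n -> L) :=
  [/\ forall i, S (b i),
      forall c : 'I_n -> K, \sum_i c i *: b i = 0 -> forall i, c i = 0 &
      forall v, S v -> exists c : 'I_n -> K, v = \sum_i c i *: b i].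

(* Dimension of a linear subspace, valued in the extended naturals:
   [None] stands for +oo. *)
Definition dimension (S : set L) : option nat :=
  xget None [set d | exists2 n, d = Some n & exists b : 'I_n -> L, basis_in S b].

Lemma basis_in_leq (S : set L) m n (b : 'I_m -> L) (c : 'I_n -> L) :
  basis_in S b -> basis_in S c -> (m <= n)%N.
Proof.
move=> [bS bfree _] [_ _ cspan].
have /choice[M bM] : forall i, exists M : 'I_n -> K, b i = \sum_j M j *: c j.
  by move=> i; exact: cspan.
pose A := \matrix_(i < m, j < n) M i j.
suff /eqP <- : row_free A by exact: rank_leq_col.
rewrite -kermx_eq0; apply/eqP/row_matrixP => k; rewrite row0.
have : row k (kermx A) *m A = 0 by rewrite -row_mul mulmx_ker row0.
move: (row k _) => u uA; apply/rowP => i; rewrite mxE.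
apply: (bfree (fun i => u 0 i)).
under eq_bigr do rewrite bM scaler_sumr.
rewrite exchange_big big1//= => j _.
under eq_bigr do rewrite scalerA.
have sj : \sum_i u 0 i * M i j = (u *m A) 0 j.
  by rewrite mxE; apply: eq_bigr => l _; rewrite mxE.
by rewrite -scaler_suml sj uA mxE scale0r.
Qed.

Lemma dimension_fin (S : set L) n (b : 'I_n -> L) :
  basis_in S b -> dimension S = Some n.
Proof.
move=> bS; apply: xget_unique; first by exists n => //; exists b.
move=> _ [m -> [c cS]]; congr Some.
by apply/eqP; rewrite eqn_leq (basis_in_leq cS bS) (basis_in_leq bS cS).
Qed.

End dimension.

Section deficiency.
Variables (R : realType) (V : choiceType).

Definition deficiency_plus (T : operator R V) : option nat :=
  dimension (eigenspace_op (adjoint T) 'i%C).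

Definition deficiency_minus (T : operator R V) : option nat :=
  dimension (eigenspace_op (adjoint T) (- 'i%C)).

End deficiency.

Section adjacency.
Variables (R : realType) (G : graph).

Definition adjacency0 : operator R G :=
  [set p : ell2 R G * ell2 R G | finitely_supported p.1 /\
     forall x, p.2 x = \sum_(y \in neighbours x) p.1 y].

Definition adjacency : operator R G := closure_op adjacency0.

(* When G is locally finite, the domain of [adjacency0] consists of all the
   finitely supported functions. *)
Lemma adjacency0_total (f : ell2 R G) : locally_finite G ->
  finitely_supported f -> exists g, adjacency0 (f, g).
Proof.
move=> lfG fs.
pose g (x : G) : R[i] := \sum_(y \in neighbours x) f y.
have gs : finite_set [set x | g x != 0].
  apply: (@sub_finite_set _ _ (\bigcup_(y in [set y | f y != 0]) neighbours y)).
    move=> x /= gx; apply: contrapT => nx; move/eqP: gx; apply.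
    apply: fsbig1 => y xy; apply: contrapT => /eqP fy.
    by apply: nx; exists y => //; rewrite /neighbours/= edge_sym.
  by apply: bigcup_finite => // y _; exact: lfG.
by exists (Ell2 (finitely_supported_square_summable gs)).
Qed.

End adjacency.

Arguments adjacency0 : clear implicits.
Arguments adjacency : clear implicits.

(* Main.v *)
(** Take an "antitree": its [k]-th level has [8 ^ k] vertices, and two vertices
    are adjacent iff their levels are consecutive.  Since [f x] is [z^-1] times
    a sum depending only on the level of [x], every solution of [A f = z f]
    with [z != 0] is constant on levels, hence determined by its value at the
    root.  The sums [w k] of the normalised solution over the levels satisfy
    [w (k+2) = z w (k+1) / 8 ^ (k+1) - w k], so that [|w k| <= 2 ^ k] if
    [|z| <= 1], and the squared l2-norm of the solution, which is the sum of
    [|w k| ^ 2 / 8 ^ k], is finite.  The antitree therefore has deficiency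
    indices [1], and a disjoint union of [n] copies of it (or of countably
    many) has deficiency indices [n] (or infinity). *)

From HB Require Import structures.
Require Import Defs.
From mathcomp Require Import all_boot all_order all_algebra.
From mathcomp Require Import all_classical all_reals all_analysis.
From mathcomp Require Import finmap.
From mathcomp Require Import complex ring lra zify.

Set Implicit Arguments.
Unset Strict Implicit.
Unset Printing Implicit Defensive.

Import Order.TTheory GRing.Theory Num.Theory.
Import ComplexField.Normc.

Local Open Scope classical_set_scope.
Local Open Scope ring_scope.
Local Open Scope complex_scope.

(** * Comparison of the modulus with real and imaginary parts *)

Section complex_norm.
Variable R : realType.
Implicit Types z : R[i].

Lemma normc_ge0 z : 0 <= normc z.
Proof. by case: z => a b; rewrite sqrtr_ge0. Qed.

Lemma normc_ReIm_sq z : normc z ^+ 2 = complex.Re z ^+ 2 + complex.Im z ^+ 2.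
Proof. by case: z => a b; rewrite sqr_sqrtr// addr_ge0 ?sqr_ge0. Qed.

Lemma normr_Re_le z : `|complex.Re z| <= normc z.
Proof.
rewrite -(@ler_pXn2r _ 2)// ?nnegrE ?normc_ge0//.
by rewrite normc_ReIm_sq -normrX ger0_norm ?sqr_ge0// lerDl sqr_ge0.
Qed.

Lemma normr_Im_le z : `|complex.Im z| <= normc z.
Proof.
rewrite -(@ler_pXn2r _ 2)// ?nnegrE ?normc_ge0//.
by rewrite normc_ReIm_sq -normrX ger0_norm ?sqr_ge0// lerDr sqr_ge0.
Qed.

Lemma normc_le_ReIm z : normc z <= `|complex.Re z| + `|complex.Im z|.
Proof.
rewrite -(@ler_pXn2r _ 2)// ?nnegrE ?normc_ge0 ?addr_ge0//.
rewrite normc_ReIm_sq sqrrD !real_normK ?num_real// addrAC lerDl.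
by rewrite mulrn_wge0// mulr_ge0.
Qed.

Lemma normc_conj z : normc (z^*)%R = normc z.
Proof. by case: z => a b; rewrite /normc /= sqrrN. Qed.

End complex_norm.

(** * Linearity and bounds for unordered real and complex sums *)

Section unordered_sums.
Variables (R : realType) (V : choiceType).
Local Notation esumT a := (\esum_(x in [set: V]) (a x)%:E)%E.

Lemma esum_seq (r : seq V) (a : V -> R) : uniq r -> (forall x, 0 <= a x) ->
  (forall x, x \notin r -> a x = 0) -> esumT a = (\sum_(x <- r) a x)%:E.
Proof.
move=> ur a0 ar; rewrite (_ : esumT a = \esum_(x in [set` r]) (a x)%:E)%E.
  rewrite esum_fset -?fsbig_seq ?sumEFin// => x _.
  by rewrite lee_fin.
rewrite [RHS]esum_mkcond; apply: eq_esum => x _.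
by rewrite mem_setE; case: ifPn => // /ar ->.
Qed.

(** The supports of [p] and [q] may overlap, unlike those of the positive and negative parts that
    define [rsum]; this freedom is what gives additivity. *)
Lemma rsumB (p q : V -> R) : (forall x, 0 <= p x) -> (forall x, 0 <= q x) ->
  (esumT p < +oo)%E -> (esumT q < +oo)%E ->
  rsum (fun x => p x - q x) = fine (esumT p) - fine (esumT q).
Proof.
move=> p0 q0 fp fq.
have H := @esumB R V setT (EFin \o p) (EFin \o q).
have E (u : V -> R) : (forall x, 0 <= u x) ->
    (\esum_(x in [set: V]) `|(EFin \o u) x| = esumT u)%E.
  by move=> u0; apply: eq_esum => x _ /=; rewrite ger0_norm.
rewrite /rsum H; last 4 first.
- by rewrite /summable E.
- by rewrite /summable E.
- by move=> x _; rewrite lee_fin.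
- by move=> x _; rewrite lee_fin.
have F (u : V -> R) : (forall x, 0 <= u x) -> (esumT u < +oo)%E ->
    esumT u \is a fin_num.
  move=> u0 fu; rewrite ge0_fin_numE//; apply: esum_ge0 => x _.
  by rewrite lee_fin.
by rewrite -fineB ?F.
Qed.

Definition abs_summable (a : V -> R) := (esumT (fun x => `|a x|) < +oo)%E.

Lemma le_esum_lty (a b : V -> R) : (forall x, a x <= b x) ->
  (esumT b < +oo)%E -> (esumT a < +oo)%E.
Proof.
by move=> ab; apply: le_lt_trans; apply: le_esum => x _; rewrite lee_fin.
Qed.

Lemma abs_summable_max (a : V -> R) : abs_summable a ->
  (esumT (fun x => Num.max (a x) 0) < +oo)%E.
Proof. by apply: le_esum_lty => x; rewrite ge_max ler_norm normr_ge0. Qed.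

Lemma abs_summableN (a : V -> R) :
  abs_summable a -> abs_summable (fun x => - a x).
Proof. by apply: le_esum_lty => x; rewrite normrN. Qed.


Lemma rsumE (a : V -> R) : abs_summable a -> rsum a =
  fine (esumT (fun x => Num.max (a x) 0)) -
  fine (esumT (fun x => Num.max (- a x) 0)).
Proof.
move=> fa; rewrite -rsumB; first last.
- exact/(abs_summable_max (abs_summableN fa)).
- exact: abs_summable_max.
- by move=> x; rewrite le_max lexx orbT.
- by move=> x; rewrite le_max lexx orbT.
congr rsum; apply/funext => x; case: (leP 0 (a x)) => a0.
  by rewrite max_r ?subr0// oppr_le0.
by rewrite max_l ?sub0r ?opprK// oppr_ge0 ltW.
Qed.

Lemma esum_ge0T (a : V -> R) : (forall x, 0 <= a x) -> (0 <= esumT a)%E.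
Proof. by move=> a0; apply: esum_ge0 => x _; rewrite lee_fin. Qed.

Lemma esum_fin_num (a : V -> R) : (forall x, 0 <= a x) ->
  (esumT a < +oo)%E -> esumT a \is a fin_num.
Proof. by move=> a0; rewrite ge0_fin_numE// esum_ge0T. Qed.

Lemma esumD_EFin (a b : V -> R) :
  (forall x, 0 <= a x) -> (forall x, 0 <= b x) ->
  esumT (fun x => a x + b x) = (esumT a + esumT b)%E.
Proof.
move=> a0 b0; under eq_esum do rewrite EFinD.
by rewrite esumD// => x _; rewrite lee_fin.
Qed.

(** Regroup positive and negative parts: $a-b=(a^++b^-)-(a^-+b^+)$ is a difference of nonnegative
    summable functions, to which [rsumB] applies. *)
Lemma rsum_sub (a b : V -> R) : abs_summable a -> abs_summable b ->
  rsum (fun x => a x - b x) = rsum a - rsum b.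
Proof.
move=> fa fb; rewrite (rsumE fa) (rsumE fb).
have fa' := abs_summable_max (abs_summableN fa).
have fb' := abs_summable_max (abs_summableN fb).
have {}fa := abs_summable_max fa; have {}fb := abs_summable_max fb.
have m0 (c : V -> R) x : 0 <= Num.max (c x) 0 by rewrite le_max lexx orbT.
pose p x := Num.max (a x) 0 + Num.max (- b x) 0.
pose q x := Num.max (- a x) 0 + Num.max (b x) 0.
have -> : (fun x => a x - b x) = (fun x => p x - q x).
  apply/funext => x; rewrite /p /q.
  by case: (leP (a x) 0); case: (leP (- a x) 0); case: (leP (b x) 0);
    case: (leP (- b x) 0); lra.
have p0 x : 0 <= p x by rewrite addr_ge0// (m0 a, m0 (fun x => - b x)).
have q0 x : 0 <= q x by rewrite addr_ge0// (m0 b, m0 (fun x => - a x)).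
have Ep : esumT p = (esumT (fun x => Num.max (a x) 0%R) +
                     esumT (fun x => Num.max (- b x) 0%R))%E.
  by rewrite -esumD_EFin// => x; rewrite le_max lexx orbT.
have Eq : esumT q = (esumT (fun x => Num.max (- a x) 0%R) +
                     esumT (fun x => Num.max (b x) 0%R))%E.
  by rewrite -esumD_EFin// => x; rewrite le_max lexx orbT.
rewrite rsumB// ?Ep ?Eq; [|exact: lte_add_pinfty..].
have fin (c : V -> R) : (esumT (fun x => Num.max (c x) 0) < +oo)%E ->
    esumT (fun x => Num.max (c x) 0) \is a fin_num.
  by apply: esum_fin_num; exact: m0.
rewrite !fineD ?(fin a) ?(fin b) ?(fin (fun x => - a x))
  ?(fin (fun x => - b x))//.
ring.
Qed.

(** The sums of the positive and of the negative part both lie in $[0,M]$, hence their difference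
    lies in $[-M,M]$. *)
Lemma rsum_le (a : V -> R) (M : R) :
  (esumT (fun x => `|a x|) <= M%:E)%E -> `|rsum a| <= M.
Proof.
move=> aM; have fa : abs_summable a.
  by rewrite /abs_summable (le_lt_trans aM)// ltry.
have H (b : V -> R) : abs_summable b -> (forall x, `|b x| = `|a x|) ->
    0 <= fine (esumT (fun x => Num.max (b x) 0)) <= M.
  move=> fb ba; have m0 x : 0 <= Num.max (b x) 0 by rewrite le_max lexx orbT.
  have fm := abs_summable_max fb.
  rewrite fine_ge0 ?esum_ge0T//= -lee_fin fineK ?esum_fin_num//.
  apply: le_trans aM; apply: le_esum => x _.
  by rewrite lee_fin -ba ge_max ler_norm normr_ge0.
rewrite rsumE// ler_norml.
have /andP[] := H _ fa (fun=> erefl).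
have /andP[] := H _ (abs_summableN fa) (fun=> normrN _).
by move: (fine _) (fine _) => u v; lra.
Qed.

Lemma rsum_seq (r : seq V) (a : V -> R) : uniq r ->
  (forall x, x \notin r -> a x = 0) -> rsum a = \sum_(x <- r) a x.
Proof.
move=> ur ar; have m0 (c : V -> R) x : 0 <= Num.max (c x) 0.
  by rewrite le_max lexx orbT.
have fa : abs_summable a.
  by rewrite /abs_summable (esum_seq ur) ?ltry// => x /ar ->; rewrite normr0.
have E (c : V -> R) : (forall x, x \notin r -> c x = 0) ->
    esumT (fun x => Num.max (c x) 0) = (\sum_(x <- r) Num.max (c x) 0)%:E.
  by move=> cr; apply: esum_seq => // x /cr ->; rewrite maxxx.
rewrite rsumE// E// E => [|x /ar ->]; last by rewrite oppr0.
rewrite /=.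
rewrite -sumrB; apply: eq_bigr => x _.
by case: (leP (a x) 0); case: (leP (- a x) 0); lra.
Qed.

Definition cabs_summable (a : V -> R[i]) :=
  (esumT (fun x => normc (a x)) < +oo)%E.

Lemma csum_sub (a b : V -> R[i]) : cabs_summable a -> cabs_summable b ->
  csum (fun x => a x - b x) = csum a - csum b.
Proof.
move=> fa fb; rewrite /csum.
have H (F : R[i] -> R) : (forall w, `|F w| <= normc w) ->
    (forall v w, F (v - w) = F v - F w) ->
    rsum (fun x => F (a x - b x)) = rsum (F \o a) - rsum (F \o b).
  move=> Fn FB; under eq_fun do rewrite FB.
  by apply: rsum_sub; [move: fa | move: fb]; apply: le_esum_lty => x; exact: Fn.
rewrite (H (@complex.Re R) (@normr_Re_le R)); last by case=> ? ? [].
by rewrite (H (@complex.Im R) (@normr_Im_le R)); last by case=> ? ? [].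
Qed.

(** The factor 2 comes from bounding real and imaginary parts separately; this crude constant
    suffices for the continuity of [ip]. *)
Lemma csum_le (a : V -> R[i]) (M : R) :
  (esumT (fun x => normc (a x)) <= M%:E)%E -> normc (csum a) <= 2 * M.
Proof.
move=> aM; apply: le_trans (normc_le_ReIm _) _.
rewrite mulr2n mulrDl mul1r lerD//; apply: rsum_le; apply: le_trans aM;
  apply: le_esum => x _; rewrite lee_fin.
- exact: normr_Re_le.
- exact: normr_Im_le.
Qed.

Lemma csum_seq (r : seq V) (a : V -> R[i]) : uniq r ->
  (forall x, x \notin r -> a x = 0) -> csum a = \sum_(x <- r) a x.
Proof.
move=> ur ar; rewrite /csum !(rsum_seq ur); try by move=> x /ar ->.
by elim: r {ur ar} => [|x r IH]; rewrite ?big_nil// !big_cons -IH; case: (a x).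
Qed.

End unordered_sums.

(** * The inner product, and the adjoint of a closure *)

Section inner_product.
Variables (R : realType) (V : choiceType).
Implicit Types (f u v : ell2 R V) (T : operator R V).

Lemma l2norm_sq f :
  (\esum_(x in [set: V]) (normc (f x) ^+ 2)%:E = (l2norm f ^+ 2)%:E)%E.
Proof.
have f0 : (0 <= \esum_(x in [set: V]) (normc (f x) ^+ 2)%:E)%E.
  by apply: esum_ge0T => x; exact: sqr_ge0.
rewrite sqr_sqrtr ?fine_ge0// fineK// ge0_fin_numE//.
by have /asboolP := ell2P f.
Qed.

Lemma l2norm_ge0 f : 0 <= l2norm f. Proof. exact: sqrtr_ge0. Qed.

Lemma l2norm0 : l2norm (0 : ell2 R V) = 0.
Proof.
rewrite /l2norm esum1 ?sqrtr0// => x _.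
by rewrite (_ : (0 : ell2 R V) x = 0)// normc0 expr0n.
Qed.

(** A weighted AM-GM inequality takes the place of Cauchy-Schwarz. The weight [t] is free: [t = 1]
    gives summability, and a large [t] makes the bound small when [u] is small. *)
Lemma esum_ip_le u f (t : R) : 0 < t ->
  (\esum_(x in [set: V]) (normc ((u x)^*%R * f x))%:E <=
   (t * l2norm u ^+ 2 + t^-1 * l2norm f ^+ 2)%:E)%E.
Proof.
move=> t0; have ti0 : 0 < t^-1 by rewrite invr_gt0.
rewrite EFinD (EFinM t) (EFinM t^-1) -!l2norm_sq.
have Z (c : R) (h : V -> R) : 0 <= c -> (forall x, 0 <= h x) ->
  (\esum_(x in [set: V]) (c * h x)%:E <=
   c%:E * \esum_(x in [set: V]) (h x)%:E)%E.
  move=> c0 h0; apply: ge_ereal_sup => _ [A fA <-].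
  rewrite (eq_fsbigr (fun x => c%:E * (h x)%:E)%E)//.
  rewrite -ge0_mule_fsumr; last by move=> x; rewrite lee_fin.
  by apply: lee_wpmul2l => //; apply: ereal_sup_ubound; exists A.
have sq0 (g : ell2 R V) x : 0 <= normc (g x) ^+ 2 by exact: sqr_ge0.
apply: le_trans (leeD (Z _ _ (ltW t0) (sq0 u)) (Z _ _ (ltW ti0) (sq0 f))).
rewrite -esumD_EFin; last 2 first.
- by move=> x; rewrite mulr_ge0// ltW.
- by move=> x; rewrite mulr_ge0// ltW.
apply: le_esum => x _; rewrite lee_fin normcM normc_conj.
(* AM-GM: [a b <= t a^2 + b^2 / t] *)
have [a0 b0] := (normc_ge0 (u x), normc_ge0 (f x)).
move: (normc _) (normc _) a0 b0 => b a a0 b0.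
rewrite -subr_ge0 (_ : _ - _ = t^-1 * ((t * a - b) ^+ 2 + t * (a * b))).
  by rewrite mulr_ge0 ?addr_ge0 ?sqr_ge0 ?mulr_ge0// ltW.
by field; rewrite gt_eqF.
Qed.

Lemma ip_subl u v f : ip (u - v) f = ip u f - ip v f.
Proof.
have S (w : ell2 R V) : cabs_summable (fun x => (w x)^*%R * f x).
  by rewrite /cabs_summable (le_lt_trans (esum_ip_le w f ltr01)) ?ltry.
rewrite -csum_sub//; congr csum; apply/funext => x.
by rewrite (_ : (u - v) x = u x - v x)// rmorphB mulrBl.
Qed.

Lemma ip_le u f (t : R) : 0 < t ->
  normc (ip u f) <= 2 * (t * l2norm u ^+ 2 + t^-1 * l2norm f ^+ 2).
Proof. by move=> t0; apply: csum_le; exact: esum_ip_le. Qed.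

Lemma ip_seql (r : seq V) u f : uniq r -> (forall x, x \notin r -> u x = 0) ->
  ip u f = \sum_(x <- r) (u x)^*%R * f x.
Proof.
by move=> ur ur0; apply: csum_seq => // x /ur0 ->; rewrite rmorph0 mul0r.
Qed.

Lemma sub_closure_op T : T `<=` closure_op T.
Proof. by move=> p Tp e e0; exists p => //; rewrite !subrr l2norm0. Qed.

(** The adjoint relation passes to limits because [ip] is continuous in its left argument.
    Deficiency indices can thus be computed from the operator before closure. *)
Lemma adjoint_closure_op T : adjoint (closure_op T) = adjoint T.
Proof.
apply/seteqP; split=> [p Tp q /sub_closure_op/Tp//|p Tp q clq].
apply/eqP; rewrite -subr_eq0; apply/eqP/eq0_normc/eqP.
rewrite eq_le normc_ge0 andbT; apply/ler_addgt0Pl => d d0; rewrite addr0.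
(* Chosen so that the two error terms, bounded by [B] below, add up to exactly [e * c = d]. *)
set c := 2 * (2 + l2norm p.1 ^+ 2 + l2norm p.2 ^+ 2).
have c0 : 0 < c by rewrite mulr_gt0// -addrA ltr_wpDr// addr_ge0 ?sqr_ge0.
pose e := d / c; have e0 : 0 < e by rewrite divr_gt0.
have [q' Tq' [q1 q2]] := clq e e0.
have -> : ip q.2 p.1 - ip q.1 p.2 =
    ip (q.2 - q'.2) p.1 - ip (q.1 - q'.1) p.2.
  by rewrite !ip_subl (Tp _ Tq'); ring.
(* The weight [t = e^-1] turns both terms of [ip_le] into multiples of [e]. *)
have B u f : l2norm u < e -> normc (ip u f) <= 2 * (e * (1 + l2norm f ^+ 2)).
  move=> ue; apply: le_trans (ip_le u f (t := e^-1) _) _.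
    by rewrite invr_gt0.
  rewrite invrK ler_pM2l// mulrDr mulr1 lerD2r mulrC ler_pdivrMr// -expr2.
  by rewrite lerXn2r ?nnegrE ?l2norm_ge0// ltW.
apply: le_trans (le_normcD _ _) _; rewrite (normcN (ip _ _)).
apply: le_trans (lerD (B _ p.1 q2) (B _ p.2 q1)) _.
rewrite (_ : _ + _ = e * c); last by rewrite /c; ring.
by rewrite /e divfK// gt_eqF.
Qed.

End inner_product.

(** * Eigenfunctions of the adjoint as pointwise solutions *)

Section adjacency_eigenspace.
Variables (R : realType) (G : graph).
Implicit Types (f : ell2 R G) (x y : G).

Lemma mem_neighbours x y : (y \in neighbours x) = edge x y.
Proof. by rewrite /neighbours mem_setE. Qed.

Lemma sum_neighbours_fset (N : {fset G}) (f : G -> R[i]) x :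
  (forall y, edge x y -> y \notin N -> f y = 0) ->
  \sum_(y \in neighbours x) f y = \sum_(y <- N) (edge x y)%:R * f y.
Proof.
move=> fN; rewrite fsbig_mkcond (fsbigTE N) => [|y yN].
  apply: eq_bigr => y _; rewrite /patch mem_neighbours.
  by case: (edge x y); rewrite (mul1r, mul0r).
by rewrite /patch mem_neighbours; case: ifPn => // /fN ->.
Qed.

(** The adjoint acts by the same neighbour sum as the adjacency matrix. One direction tests against
    delta functions, the other exchanges finite sums using the symmetry of [edge]. *)
Lemma eigenspace_adjacency (z : R[i]) f : locally_finite G ->
  eigenspace_op (adjoint (adjacency R G)) z f <->
  forall x, \sum_(y \in neighbours x) f y = z * f x.
Proof.
move=> lfG; rewrite /eigenspace_op /adjacency adjoint_closure_op.
split=> [Hf x|Hf].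
  (* The adjacency matrix sends the delta function at [x] to the indicator of the neighbours of
     [x]. *)
  pose d y : R[i] := (y == x)%:R.
  have d0 y : y \notin [fset x]%fset -> d y = 0.
    by rewrite inE /d => /negbTE ->.
  have dS : finitely_supported d.
    apply: (sub_finite_set _ (finite_set1 x)) => y /=; rewrite /d.
    by case: (y =P x) => //; rewrite eqxx.
  pose d2 := Ell2 (finitely_supported_square_summable dS).
  have [g Ag] := adjacency0_total (f := d2) lfG dS.
  have gE y : g y = (edge y x)%:R.
    rewrite (Ag.2 y) (@sum_neighbours_fset [fset x]%fset) => [|w _ /d0//].
    by rewrite big_seq_fset1 /= /d eqxx mulr1.
  have := Hf _ Ag.
  rewrite (@ip_seql _ _ (fset_set (neighbours x)))//=; first last.
  - move=> y; rewrite in_fset_set ?mem_neighbours; last exact: lfG.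
    by rewrite gE edge_sym => /negbTE ->.
  rewrite (@ip_seql _ _ [fset x]%fset)//= big_seq_fset1 /= /d eqxx.
  rewrite rmorph1 mul1r => Hx; rewrite -[RHS]Hx.
  rewrite (fsbig_finite _ _ (lfG x)).
  rewrite big_seq [RHS]big_seq; apply: eq_bigr => y.
  rewrite in_fset_set ?mem_neighbours; last exact: lfG.
  by rewrite gE edge_sym => ->; rewrite rmorph1 mul1r.
move=> [h g] [/= hS hg].
pose S := fset_set [set y | h y != 0].
(* [S] is the support of [h], and [N] contains that of [g], so both inner products become finite
   sums. *)
pose N := fset_set (\bigcup_(y in [set y | h y != 0]) neighbours y).
have hS0 y : y \notin S -> h y = 0.
  by rewrite in_fset_set// mem_setE negbK => /eqP.
have NP y x : h y != 0 -> edge x y -> x \in N.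
  move=> hy xy; rewrite in_fset_set; last first.
    by apply: bigcup_finite => // w _; exact: lfG.
  by apply: mem_set; exists y => //; rewrite /neighbours /= edge_sym.
have gE x : g x = \sum_(y <- S) (edge x y)%:R * h y.
  by rewrite hg; apply: sum_neighbours_fset => y _ /hS0.
rewrite (@ip_seql _ _ N)//; last first.
  move=> x xN; rewrite hg; apply: fsbig1 => y xy; apply: contraNeq xN => hy.
  exact: NP xy.
rewrite (@ip_seql _ _ S)//=.
transitivity (\sum_(x <- N) \sum_(y <- S) (edge x y)%:R * ((h y)^*%R * f x)).
  apply: eq_bigr => x _; rewrite gE rmorph_sum mulr_suml; apply: eq_bigr => y _.
  by rewrite rmorphM rmorph_nat mulrA.
rewrite exchange_big /= big_seq [RHS]big_seq; apply: eq_bigr => y yS.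
rewrite -[X in _ * X]/(z * f y) -Hf (@sum_neighbours_fset N); last first.
  move=> x yx; case/negP; apply: (NP y); last by rewrite edge_sym.
  by move: yS; rewrite in_fset_set// mem_setE.
by rewrite mulr_sumr; apply: eq_bigr => x _; rewrite edge_sym mulrCA.
Qed.

End adjacency_eigenspace.

(** * The recursion for the level sums, and its growth *)

Section weights.
Variables (R : realType) (z : R[i]).

(** The sum over level [k] of the eigenfunction equal to 1 at the root; the recursion is the
    eigenvalue equation averaged over level [k.-1]. *)
Fixpoint weight (k : nat) : R[i] :=
  match k with
  | 0 => 1
  | k1.+1 => match k1 with
             | 0 => z
             | k0.+1 => z * weight k1 / (8 ^ k1)%:R - weight k0
             end
  end.

(** The common value of that eigenfunction at the vertices of level [k]. *)
Definition amplitude k := weight k / (8 ^ k)%:R.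

Lemma pow8_neq0 k : (8 ^ k)%:R != 0 :> R[i].
Proof. by rewrite pnatr_eq0 expn_eq0. Qed.

Lemma amplitude_sum k : amplitude k *+ 8 ^ k = weight k.
Proof. by rewrite -mulr_natr divfK// pow8_neq0. Qed.

Lemma weightSS k : weight k.+2 = z * weight k.+1 / (8 ^ k.+1)%:R - weight k.
Proof. by []. Qed.

(** The eigenvalue equation at a vertex of level [k]; the default 0 reflects that the root has no
    previous level. *)
Lemma weight_rec k :
  weight k.+1 + (if k is k'.+1 then weight k' else 0) = z * amplitude k.
Proof.
rewrite /amplitude; case: k => [|k].
  by rewrite addr0 /= expn0 divr1 mulr1.
by rewrite weightSS subrK mulrA.
Qed.

Lemma normc_natr n : normc (n%:R : R[i]) = n%:R.
Proof. by rewrite -mulr_natr mul1r normcMn normc1. Qed.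

(** Two consecutive bounds are carried through the induction: the factor $z/8^{k+1}$ has modulus at
    most 1, and $2^{k+1}+2^k\le 2^{k+2}$. *)
Lemma normc_weight k : normc z <= 1 -> normc (weight k) <= (2 ^ k)%:R.
Proof.
move=> z1; suff /(_ k)[] : forall k, normc (weight k) <= (2 ^ k)%:R /\
    normc (weight k.+1) <= (2 ^ k.+1)%:R by [].
elim=> [|{}k [IH0 IH1]].
  by rewrite normc1; split=> //; apply: le_trans z1 _; rewrite ler1n.
split=> //; rewrite weightSS.
apply: le_trans (le_normcD _ _) _; rewrite (normcN (weight k)).
apply: (@le_trans _ _ ((2 ^ k.+1)%:R + (2 ^ k)%:R)); last first.
  by rewrite -natrD ler_nat !expnS; lia.
apply: lerD => //; rewrite !normcM normcV normc_natr.
apply: le_trans IH1; rewrite ler_pdivrMr ?ltr0n ?expn_gt0//.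
rewrite mulrC ler_wpM2l ?normc_ge0//.
by apply: le_trans z1 _; rewrite ler1n expn_gt0.
Qed.

(** The left side is the squared norm carried by level [k], at most $4^k/8^k=2^{-k}$; the bound is
    written in the form that [epsilon_trick0] sums. *)
Lemma amplitude_mass k : normc z <= 1 ->
  normc (amplitude k) ^+ 2 *+ 8 ^ k <= 2 / (2 ^ k.+1)%:R.
Proof.
move=> z1; have p n m : (0 : R) < ((n.+1 ^ m)%N)%:R by rewrite ltr0n expn_gt0.
rewrite -mulr_natr normcM normcV normc_natr exprMn -mulrA.
rewrite (_ : _ * (8 ^ k)%:R = ((8 ^ k)%:R)^-1); last by field; rewrite gt_eqF.
rewrite ler_pdivrMr//; apply: (@le_trans _ _ (((2 ^ k)%:R) ^+ 2)).
  by rewrite lerXn2r ?nnegrE ?normc_ge0 ?normc_weight.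
rewrite mulrAC ler_pdivlMr// -natrX -!natrM ler_nat.
by rewrite -expnM -!expnD -(expnM 2 3) -expnS leq_exp2l//; lia.
Qed.

End weights.

(** * Copies of the antitree: levels, neighbours and neighbour sums *)

Section antitree.
Variable I : countType.

(* [Tagged _ j] with [tag] equal to [(i, k)] is the [j]-th of the [8 ^ k]
   vertices at distance [k] from the root of the [i]-th copy. *)
Definition antitree_vertex : Type := {p : I * nat & 'I_(8 ^ p.2)}.

HB.instance Definition _ := Countable.on antitree_vertex.

Definition level (p : I * nat) : set antitree_vertex := [set x | tag x = p].

Definition antitree_edge : rel antitree_vertex := fun x y =>
  ((tag x).1 == (tag y).1) &&
  (((tag y).2 == (tag x).2.+1) || ((tag x).2 == (tag y).2.+1)).

Lemma antitree_edge_sym : symmetric antitree_edge.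
Proof. by move=> x y; rewrite /antitree_edge eq_sym orbC. Qed.

Lemma antitree_edge_irrefl : irreflexive antitree_edge.
Proof. by move=> x; rewrite /antitree_edge orbb (ltn_eqF (ltnSn _)) andbF. Qed.

Definition antitree := Graph antitree_edge_sym antitree_edge_irrefl.

Definition vtx (i : I) (k : nat) (j : 'I_(8 ^ k)) : antitree :=
  Tagged (fun p : I * nat => 'I_(8 ^ p.2)) (j : 'I_(8 ^ (i, k).2)).

Definition root_vtx (i : I) : antitree := vtx i (ord0 : 'I_(8 ^ 0)).

Lemma level_image p : level p = [set vtx p.1 j | j in [set: 'I_(8 ^ p.2)]].
Proof.
apply/seteqP; split=> [[q j] /= <-|_ [j _ <-]].
  by exists j => //; case: q j.
by case: p j.
Qed.

Lemma vtx_inj i k : injective (@vtx i k).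
Proof. by move=> j j' /eqP; rewrite /vtx eq_Tagged => /eqP. Qed.

Lemma finite_level p : finite_set (level p).
Proof. by rewrite level_image; exact: finite_image. Qed.

Lemma sum_level (M : nmodType) p (f : antitree_vertex -> M) :
  \sum_(x \in level p) f x = \sum_(j < 8 ^ p.2) f (vtx p.1 j).
Proof.
rewrite level_image fsbig_image; last by move=> j j' _ _; exact: vtx_inj.
rewrite [RHS]fsbig_seq ?index_enum_uniq//.
by apply: eq_fsbigl; apply/seteqP; split=> j _ //=; exact: mem_index_enum.
Qed.

Definition prev_level (p : I * nat) : set antitree_vertex :=
  if p.2 is k.+1 then level (p.1, k) else set0.

Lemma neighbours_level (x : antitree) :
  neighbours x = level ((tag x).1, (tag x).2.+1) `|` prev_level (tag x).
Proof.
apply/seteqP; split=> y; rewrite /neighbours/prev_level/level/= /antitree_edge.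
  move=> /andP[/eqP ->] /orP[/eqP <-|/eqP ->].
    by left; case: (tag y).
  by right=> /=; case: (tag y).
case=> [->|]; first by rewrite !eqxx.
by case: (tag x) => i [|k]//= ->; rewrite /= !eqxx orbT.
Qed.

Lemma finite_prev_level p : finite_set (prev_level p).
Proof. by rewrite /prev_level; case: p.2 => // k; exact: finite_level. Qed.

Lemma antitree_locally_finite : locally_finite antitree.
Proof.
move=> x; rewrite neighbours_level finite_setU; split.
  exact: finite_level.
exact: finite_prev_level.
Qed.

Lemma sum_neighbours (R : realType) (f : antitree -> R[i]) (x : antitree) :
  \sum_(y \in neighbours x) f y =
  \sum_(j < 8 ^ (tag x).2.+1) f (vtx (tag x).1 j) +
  (if (tag x).2 is k.+1 then \sum_(j < 8 ^ k) f (vtx (tag x).1 j) else 0).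
Proof.
rewrite neighbours_level fsbigU0.
- rewrite sum_level; congr (_ + _); rewrite /prev_level.
  by case: (tag x).2 => [|k]; rewrite (fsbig_set0, sum_level).
- exact: finite_level.
- exact: finite_prev_level.
(* The next and the previous level are disjoint, since their indices differ by 2. *)
- rewrite /prev_level; case: (tag x) => i [|k] y []//.
  rewrite /level/= => -> [].
  lia.
Qed.

End antitree.

(** * Existence and uniqueness of radial eigenfunctions *)

Section antitree_eigenspace.
Variables (R : realType) (I : countType) (z : R[i]).
Hypotheses (z0 : z != 0) (z1 : normc z <= 1).
Local Notation G := (antitree I).
Local Notation eigenfunctions :=
  (eigenspace_op (adjoint (adjacency R G)) z).

(** The normalised solution on copy [i], extended by zero to the other copies. *)
Definition radial (i : I) (x : G) : R[i] :=
  if (tag x).1 == i then amplitude z (tag x).2 else 0.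

Lemma radial_root i j : radial i (root_vtx j) = (j == i)%:R.
Proof. by rewrite /radial /=; case: eqP => // _; rewrite /amplitude divr1. Qed.

Lemma radial_square_summable i : radial i \in @square_summable R G.
Proof.
apply/asboolP.
have sq0 x : (0 <= (normc (radial i x) ^+ 2)%:E)%E by rewrite lee_fin sqr_ge0.
pose J k := level (i, k).
(* The function vanishes outside copy [i], so the sum splits over the levels of that copy and is
   dominated by a geometric series. *)
have -> : (\esum_(x in [set: G]) (normc (radial i x) ^+ 2)%:E =
    \esum_(x in \bigcup_(k in [set: nat]) J k) (normc (radial i x) ^+ 2)%:E)%E.
  rewrite [RHS]esum_mkcond; apply: eq_esum => x _; case: ifPn => // /negP xJ.
  rewrite /radial ifF ?normc0 ?expr0n//; apply/eqP => xi; apply: xJ.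
  apply: mem_set; exists (tag x).2 => //.
  by rewrite /J /level /= -xi; case: (tag x).
rewrite esum_bigcupT//; last first.
  by move=> k l _ _ [x []]; rewrite /J /level /= => -> [].
apply: (@le_lt_trans _ _ (\esum_(k in [set: nat]) (2 / (2 ^ k.+1)%:R)%:E)%E).
  apply: le_esum => k _; rewrite esum_fset//; last exact: finite_level.
  rewrite sum_level sumEFin lee_fin /=.
  rewrite (eq_bigr (fun=> normc (amplitude z k) ^+ 2)); last first.
    by move=> j _; rewrite /radial /= eqxx.
  by rewrite sumr_const card_ord amplitude_mass.
rewrite -nneseries_esumT; last by move=> k; rewrite lee_fin divr_ge0.
by apply: le_lt_trans (epsilon_trick0 _ _) _; rewrite ?ltry.
Qed.

Definition radial_ell2 i : ell2 R G := Ell2 (radial_square_summable i).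

Lemma radial_eigenfunction i : eigenfunctions (radial_ell2 i).
Proof.
apply/(eigenspace_adjacency _ _ (@antitree_locally_finite I)) => x.
have S k : \sum_(j < 8 ^ k) radial i (vtx (tag x).1 j) =
    if (tag x).1 == i then weight z k else 0.
  rewrite (eq_bigr (fun=> if (tag x).1 == i then amplitude z k else 0))//.
  rewrite sumr_const card_ord; case: eqP => _; last exact: mul0rn.
  exact: amplitude_sum.
rewrite sum_neighbours /= S.
transitivity (if (tag x).1 == i then z * amplitude z (tag x).2 else 0).
  rewrite -weight_rec; case: (tag x).2 => [|k]; rewrite ?S;
    by case: ifP => _; rewrite ?addr0.
by rewrite /radial; case: ifP => _; rewrite ?mulr0.
Qed.

(** The sums of [f] over the levels of a copy obey the recursion of [weight], so the root value
    fixes them; since [z != 0], they in turn fix [f] at each vertex. *)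
Lemma eigenfunctionE (f : ell2 R G) (x : G) : eigenfunctions f ->
  f x = amplitude z (tag x).2 * f (root_vtx (tag x).1).
Proof.
move/(eigenspace_adjacency _ _ (@antitree_locally_finite I)) => Hf.
case: x => -[i k] j /=; rewrite -[LHS]/(f (vtx i j)).
pose F k := \sum_(j < 8 ^ k) f (vtx i j).
(* The right side does not depend on [j']. *)
have HF l (j' : 'I_(8 ^ l)) :
    z * f (vtx i j') = F l.+1 + (if l is l'.+1 then F l' else 0).
  by rewrite -Hf sum_neighbours.
have F0 : F 0 = f (root_vtx i) by rewrite /F big_ord1.
have FE l : F l = weight z l * F 0.
  suff /(_ l)[] : forall l, F l = weight z l * F 0 /\
    F l.+1 = weight z l.+1 * F 0 by [].
  elim=> [|{}l [IH0 IH1]].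
    by rewrite mul1r; split=> //; rewrite F0 (HF 0) addr0.
  (* Summing [HF] over level [l.+1] yields a recursion for [F] alone, which matches [weightSS] once
     the factor [8 ^ l.+1] is cancelled. *)
  split=> //; have : \sum_(j' < 8 ^ l.+1) z * f (vtx i j') =
      (F l.+2 + F l) *+ 8 ^ l.+1.
    rewrite -[_ *+ _](_ : \sum_(j' < 8 ^ l.+1) (F l.+2 + F l) = _).
      by apply: eq_bigr => j' _; rewrite HF.
    by rewrite sumr_const card_ord.
  rewrite -mulr_sumr -/(F l.+1) -mulr_natr weightSS IH0 IH1.
  have := pow8_neq0 R l.+1; move: (8 ^ l.+1)%:R => s s0 H.
  apply: (mulIf s0); rewrite mulrAC mulrBl divfK//.
  have -> : F l.+2 * s = z * (weight z l.+1 * F 0) - weight z l * F 0 * s.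
    by rewrite H; ring.
  by move: (weight _ _) (weight _ _) => u v; ring.
apply: (mulfI z0); rewrite HF mulrA -weight_rec mulrDl -F0 -FE; congr (_ + _).
by case: k {j} => [|k]; [rewrite mul0r | exact: FE].
Qed.

End antitree_eigenspace.

(** * Dimension of the eigenspaces, and the deficiency indices *)

Section antitree_deficiency.
Variables (R : realType) (z : R[i]).
Hypotheses (z0 : z != 0) (z1 : normc z <= 1).

Lemma ell2_sumE (V : choiceType) n (c : 'I_n -> R[i]) (b : 'I_n -> ell2 R V) x :
  (\sum_i c i *: b i) x = \sum_i c i * b i x.
Proof. exact: (big_morph (fun f : ell2 R V => f x)). Qed.

(** The radial functions form a basis, dual to evaluation at the roots: coordinates are read off as
    root values, and [eigenfunctionE] gives spanning. *)
Lemma dimension_copies n :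
  dimension (eigenspace_op (adjoint (adjacency R (antitree 'I_n))) z) = Some n.
Proof.
apply: (@dimension_fin _ _ _ _ (radial_ell2 z1)); split=> [i|c c0 i|f Sf].
- exact: radial_eigenfunction.
- have := congr1 (fun f : ell2 R _ => f (root_vtx i)) c0.
  rewrite /= ell2_sumE (bigD1 i)//= radial_root eqxx mulr1.
  rewrite big1 ?addr0// => j ji.
  by rewrite radial_root eq_sym (negbTE ji) mulr0.
exists (fun i => f (root_vtx i)); apply/val_inj/funext => x /=.
rewrite ell2_sumE (bigD1 (tag x).1)//= big1 => [|j jx].
  by rewrite addr0 /radial eqxx mulrC; exact: eigenfunctionE.
by rewrite /radial eq_sym (negbTE jx) mulr0.
Qed.

(** If [n] vectors spanned the eigenspace, evaluating [n.+1] radial functions at their roots would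
    factor an identity matrix of rank [n.+1] through dimension [n]. *)
Lemma dimension_infinitely_many_copies :
  dimension (eigenspace_op (adjoint (adjacency R (antitree nat))) z) = None.
Proof.
apply: xgetPN => d [n _ [b [_ _ bspan]]].
have /choice[M bM] : forall i : nat, exists M : 'I_n -> R[i],
    radial_ell2 z1 i = \sum_j M j *: b j.
  by move=> i; apply: bspan; exact: radial_eigenfunction.
pose A := \matrix_(i < n.+1, j < n) M i j.
pose B := \matrix_(j < n, i < n.+1) b j (root_vtx (i : nat)).
have AB : A *m B = 1%:M.
  apply/matrixP => i j; rewrite !mxE.
  transitivity (radial_ell2 z1 (i : nat) (root_vtx (j : nat))).
    by rewrite bM ell2_sumE; apply: eq_bigr => k _; rewrite !mxE.
  by rewrite /= radial_root eq_sym.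
by have := mulmx_max_rank A B; rewrite AB mxrank1 ltnn.
Qed.

End antitree_deficiency.

Theorem theorem1 (R : realType) (n : option nat) :
  exists G : graph, locally_finite G /\
    deficiency_plus (adjacency R G) = n /\
    deficiency_minus (adjacency R G) = n.
Proof.
(* Both spectral parameters, ['i] and [- 'i], are nonzero of modulus at most 1, so the same
   dimension count serves both indices. *)
have i0 : 'i%C != 0 :> R[i] by rewrite eq_complex /= eqxx oner_eq0.
have i1 : normc ('i%C : R[i]) <= 1.
  by rewrite /normc /= expr0n expr1n add0r sqrtr1.
have Ni0 : - 'i%C != 0 :> R[i] by rewrite oppr_eq0.
have Ni1 : normc (- 'i%C : R[i]) <= 1 by rewrite (normcN ('i%C : R[i])).
case: n => [n|].
  exists (antitree 'I_n); split; first exact: antitree_locally_finite.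
  by split; exact: dimension_copies.
exists (antitree nat); split; first exact: antitree_locally_finite.
by split; exact: dimension_infinitely_many_copies.
Qed.
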